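(* Let $R$ be any o-minimal expansion of a (real closed) field not isomorphic to the field $\mathbb{R}$ of real numbers. Then there are already uncountably many different objects of $\mathbf{LDS}(R)$ that come from the line $R^1$.
   Context: Let $R$ be an o-minimal expansion of a real closed field; ''definable'' means definable in $R$ with parameters. Generalized topological space: a set $M$ with a family of subsets (the open sets) and a collection of families of open sets (the admissible families; such a family is an admissible covering of its union) such that: (A1) $\emptyset$ and $M$ are open; (A2) finite unions and finite intersections of open sets are open; (A3) finite families of open sets are admissible; (A4) the union of an admissible family is open; (A5) if $\{U_i\}$ is admissible and $V\subseteq\bigcup_i U_i$ is open, then $\{V\cap U_i\}$ is admissible; (A6) if $\{U_i\}$ is admissible and for each $i$ the family $\{V_{ij}\}_j$ is admissible with union $U_i$, then $\{V_{ij}\}_{i,j}$ is admissible; (A7) if $\{U_i\}$ is a family of open sets, $\{V_j\}$ is admissible with the same union, and each $V_j$ is contained in some $U_i$, then $\{U_i\}$ is admissible; (A8) if $\{U_i\}$ is admissible, $V\subseteq \bigcup_i U_i$ and each $V\cap U_i$ is open, then $V$ is open. A map is strictly continuous if preimages of admissible families are admissible. A space over $R$ is a pair $(M,O_M)$ with $M$ a generalized topological space and $O_M$ a function sheaf of rings: $O_M(U)$ is a subring of the ring of all functions $U\to R$ for each open $U$, restrictions are set-theoretic, and the sheaf property holds for admissible coverings. A morphism $f:(M,O_M)\to(N,O_N)$ is a strictly continuous map with $h\circ f\in O_M(f^{-1}(V))$ for all open $V\subseteq N$ and $h\in O_N(V)$. An open subspace is an open subset with the restricted structure. A definable set $D\subseteq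 R^n$ is regarded as a space over $R$: its open sets are the relatively open definable subsets, its admissible families are the families of open sets for which finitely many members already cover the union, and $O_D(U)$ is the ring of continuous definable functions $U\to R$. An affine definable space is a space over $R$ isomorphic to a definable subset of some $R^n$; a definable space is a space with a finite open covering by affine definable open subspaces; a locally definable space is a space with an admissible covering by affine definable open subspaces. $\mathbf{LDS}(R)$ is the category of locally definable spaces over $R$ and their morphisms as spaces. The strong topology on a locally definable space is the topology having the open sets of the generalized topology as a basis. An object $N$ of $\mathbf{LDS}(R)$ comes from $R^k$ if the underlying topological space of $N$ (with the strong topology) equals the standard topological space $R^k$ and for each $x\in R^k$ both $N$ and the affine space $R^k$ induce on an open box $B$ containing $x$ the same definable open subspace. Two such objects are different if they are not equal as spaces. *)

(* Defs.v *)
From HB Require Import structures.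
From mathcomp Require Export all_boot all_order all_algebra.
From mathcomp Require Export all_classical all_reals all_analysis.
From mathcomp Require Export Rstruct.

Set Implicit Arguments.
Unset Strict Implicit.
Unset Printing Implicit Defensive.

Import Order.TTheory GRing.Theory Num.Theory.
Export numFieldNormedType.Exports.

Local Open Scope classical_set_scope.
Local Open Scope ring_scope.

(* A first-order structure on the set F in a language extending that of
   ordered rings, whose reduct to that language is the ordered field F. *)
Record expansion (F : rcfType) := Expansion {
  fsym : Type;
  farity : fsym -> nat;
  finterp : forall s : fsym, 'rV[F]_(farity s) -> F;
  rsym : Type;
  rarity : rsym -> nat;
  rinterp : forall r : rsym, set 'rV[F]_(rarity r)
}.

Section FirstOrder.
Variables (F : rcfType) (E : expansion F).

(* Variables are de Bruijn indices. *)
Inductive term : Type :=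
| Var of nat
| Zero
| One
| Add of term & term
| Opp of term
| Mul of term & term
| App (s : fsym E) of ('I_(farity s) -> term).

Inductive formula : Type :=
| Eq of term & term
| Le of term & term
| Rel (r : rsym E) of ('I_(rarity r) -> term)
| Not of formula
| And of formula & formula
| Exists of formula.

Fixpoint eval (e : nat -> F) (t : term) : F :=
  match t with
  | Var i => e i
  | Zero => 0
  | One => 1
  | Add t1 t2 => eval e t1 + eval e t2
  | Opp t1 => - eval e t1
  | Mul t1 t2 => eval e t1 * eval e t2
  | App s ts => finterp (\row_(i < farity s) eval e (ts i))
  end.

Definition scons (y : F) (e : nat -> F) : nat -> F :=
  fun i => if i is j.+1 then e j else y.

Fixpoint holds (e : nat -> F) (phi : formula) : Prop :=
  match phi with
  | Eq t1 t2 => eval e t1 = eval e t2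
  | Le t1 t2 => eval e t1 <= eval e t2
  | Rel r ts => rinterp (\row_(i < rarity r) eval e (ts i))
  | Not psi => ~ holds e psi
  | And psi1 psi2 => holds e psi1 /\ holds e psi2
  | Exists psi => exists y : F, holds (scons y e) psi
  end.

(* The first n variables are the coordinates of x, the others are parameters
   (a formula uses only finitely many of them). *)
Definition env n (x : 'rV[F]_n) (a : nat -> F) : nat -> F :=
  fun i => if insub i is Some j then x 0 j else a (i - n)%N.

Definition definable n (D : set 'rV[F]_n) : Prop :=
  exists (phi : formula) (a : nat -> F), D = [set x | holds (env x a) phi].

(* The intervals of MathComp may be degenerate, so that points are included,
   and their endpoints are in F or infinite. *)
Definition o_minimal : Prop :=
  forall D : set 'rV[F]_1, definable D ->
  exists s : seq (interval F), D = [set x | exists2 i, i \in s & x 0 0 \in i].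

End FirstOrder.

(* The underlying set of a space is a subset of an ambient type T. An
   admissible family is represented by the set of its members. A function on U
   is represented by any total function with the given values on U: the set
   sect U of sections is saturated for agreement on U, and empty if U is not
   open (see is_space). Thus the four components are determined by the space,
   and equality in this record type is equality of spaces. *)
Record space_over (F : rcfType) (T : pointedType) := SpaceOver {
  carrier : set T;
  gopen : set (set T);
  admissible : set (set (set T));
  sect : set T -> set (T -> F)
}.

Definition fam_union T (C : set (set T)) : set T := \bigcup_(U in C) U.

Section Laws.
Variables (F : rcfType) (T : pointedType) (M : space_over F T).

Record is_gts : Prop := IsGts {
  gts_sub : forall U, gopen M U -> U `<=` carrier M;
  gts_adm_open : forall C, admissible M C -> C `<=` gopen M;
  gts_A1 : gopen M set0 /\ gopen M (carrier M);
  gts_A2 : forall U V, gopen M U -> gopen M V ->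
    gopen M (U `|` V) /\ gopen M (U `&` V);
  gts_A3 : forall C, finite_set C -> C `<=` gopen M -> admissible M C;
  gts_A4 : forall C, admissible M C -> gopen M (fam_union C);
  gts_A5 : forall C V, admissible M C -> gopen M V -> V `<=` fam_union C ->
    admissible M [set V `&` U | U in C];
  gts_A6 : forall C (D : set T -> set (set T)), admissible M C ->
    (forall U, C U -> admissible M (D U) /\ fam_union (D U) = U) ->
    admissible M (\bigcup_(U in C) D U);
  gts_A7 : forall C D, C `<=` gopen M -> admissible M D -> fam_union D = fam_union C ->
    (forall V, D V -> exists2 U, C U & V `<=` U) ->
    admissible M C;
  gts_A8 : forall C V, admissible M C -> V `<=` fam_union C ->
    (forall U, C U -> gopen M (V `&` U)) -> gopen M V
}.

Record is_space : Prop := IsSpace {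
  space_gts : is_gts;
  sect_open : forall U f, sect M U f -> gopen M U;
  sect_sat : forall U f g, sect M U f -> {in U, f =1 g} -> sect M U g;
  sect_one : forall U, gopen M U -> sect M U (fun=> 1);
  sect_sub : forall U f g, sect M U f -> sect M U g ->
    sect M U (fun x => f x - g x);
  sect_mul : forall U f g, sect M U f -> sect M U g ->
    sect M U (fun x => f x * g x);
  sect_restrict : forall U V f, gopen M V -> V `<=` U ->
    sect M U f -> sect M V f;
  sect_glue : forall C (s : set T -> T -> F), admissible M C ->
    (forall U, C U -> sect M U (s U)) ->
    (forall U V, C U -> C V -> {in U `&` V, s U =1 s V}) ->
    exists2 f, sect M (fam_union C) f & forall U, C U -> {in U, f =1 s U}
}.

Definition open_subspace (U : set T) : space_over F T :=
  {| carrier := U;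
     gopen := [set V | gopen M V /\ V `<=` U];
     admissible := [set C | admissible M C /\ forall V, C V -> V `<=` U];
     sect := fun V => [set f | V `<=` U /\ sect M V f] |}.

(* The opens of a generalized topology are closed under finite intersections,
   so the strong topology consists of the unions of opens. *)
Definition strong_open (W : set T) : Prop :=
  exists2 C : set (set T), C `<=` gopen M & W = fam_union C.

End Laws.

Definition space_preim (F : rcfType) (T T' : pointedType) (M : space_over F T)
    (f : T -> T') (V : set T') : set T :=
  carrier M `&` f @^-1` V.

Record space_morphism (F : rcfType) (T T' : pointedType) (M : space_over F T)
    (N : space_over F T') (f : T -> T') : Prop := IsSpaceMorphism {
  mor_map : forall x, carrier M x -> carrier N (f x);
  mor_strict : forall C, admissible N C -> admissible M [set space_preim M f V | V in C];
  mor_sect : forall V h, gopen N V -> sect N V h -> sect M (space_preim M f V) (h \o f)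
}.

Definition space_isomorphic (F : rcfType) (T T' : pointedType) (M : space_over F T)
    (N : space_over F T') : Prop :=
  exists (f : T -> T') (g : T' -> T),
    [/\ space_morphism M N f, space_morphism N M g,
        {in carrier M, cancel f g} & {in carrier N, cancel g f}].

Section LocallyDefinable.
Variables (F : rcfType) (E : expansion F).

Definition definable_open n (D : set 'rV[F]_n) (U : set 'rV[F]_n) : Prop :=
  definable E U /\ exists2 W : set 'rV[F]_n, open W & U = D `&` W.

Definition graph_on n (U : set 'rV[F]_n) (f : 'rV[F]_n -> F) : set 'rV[F]_(n + 1) :=
  [set row_mx x (const_mx (f x)) | x in U].

Definition definable_set_space n (D : set 'rV[F]_n) : space_over F 'rV[F]_n :=
  {| carrier := D;
     gopen := definable_open D;
     admissible := [set C | C `<=` definable_open D /\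
       exists C' : set (set 'rV[F]_n),
         [/\ C' `<=` C, finite_set C' & fam_union C' = fam_union C]];
     sect := fun U => [set f | [/\ definable_open D U,
       {within U, continuous f} & definable E (graph_on U f)]] |}.

Definition affine_definable (T : pointedType) (M : space_over F T) : Prop :=
  is_space M /\
  exists (n : nat) (D : set 'rV[F]_n),
    definable E D /\ space_isomorphic M (definable_set_space D).

Definition locally_definable (T : pointedType) (M : space_over F T) : Prop :=
  is_space M /\
  exists C : set (set T),
    [/\ admissible M C, fam_union C = carrier M &
        forall U, C U -> affine_definable (open_subspace M U)].

Definition open_box k (a b : 'rV[F]_k) : set 'rV[F]_k :=
  [set x | forall i, a 0 i < x 0 i < b 0 i].

Definition comes_from_affine k (N : space_over F 'rV[F]_k) : Prop :=
  [/\ carrier N = setT,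
      forall W : set 'rV[F]_k, strong_open N W <-> open W &
      forall x : 'rV[F]_k, exists a b : 'rV[F]_k,
        [/\ open_box a b x, gopen N (open_box a b) &
            open_subspace N (open_box a b) =
            open_subspace (definable_set_space setT) (open_box a b)]].

End LocallyDefinable.

Definition field_isomorphic (F K : fieldType) : Prop :=
  exists f : {rmorphism F -> K}, bijective f.

(* Main.v *)
(** If [F] is not isomorphic to the reals, it has a gap [A]: a Dedekind cut without
    supremum.  Choose [a] in [A] and [b] outside; the translates of [A] by the
    multiples [n (b - a)] are gaps that accumulate nowhere.  For a set [S] of
    indices, localize the affine line at the family of the intervals whose end
    points lie on the same side of the [n]-th gap for every [n] in [S]: a set is
    open when its trace on each of these intervals is, and likewise for admissible
    families and sections.  This space comes from the line, because every point has
    such an interval around it.  The lower half of the [n]-th gap is open in it if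
    and only if [n] is in [S], because by o-minimality its trace on an interval
    containing the gap is not definable.  So the spaces are pairwise different, and
    there are as many as sets of natural numbers. *)

From HB Require Import structures.
From mathcomp Require Import lra.
Require Import Defs.

Set Implicit Arguments.
Unset Strict Implicit.
Unset Printing Implicit Defensive.

Import Order.TTheory GRing.Theory Num.Theory.
Local Open Scope classical_set_scope.
Local Open Scope ring_scope.

(** * Gaps and completeness *)

Section RealTypeIsomorphism.

Lemma rat_lt_ext (K : archiRealFieldType) (x y : K) :
  (forall q : rat, (ratr q < x) = (ratr q < y)) -> x = y.
Proof.
move=> xy; apply/eqP; rewrite eq_le !leNgt.
apply/andP; split; apply/negP => /rat_in_itvoo[q]; rewrite in_itv /= => /andP[q1 q2].
- by rewrite xy ltNge (ltW q1) in q2.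
- by rewrite -xy ltNge (ltW q1) in q2.
Qed.

(** The rational cut of a sum is expressed by the rational cuts of the summands alone, so that it
    carries over to another field. The witness comes from the density of the rationals. *)
Lemma rat_ltD (K : archiRealFieldType) (x y : K) (q : rat) :
  ratr q < x + y <-> exists r : rat, ratr r < x /\ ratr (q - r) < y.
Proof.
split=> [|[r [rx ry]]].
  rewrite -ltrBlDr => /rat_in_itvoo[r]; rewrite in_itv /= => /andP[r1 r2].
  by exists r; split=> //; rewrite rmorphB /=; lra.
by move: ry; rewrite rmorphB /=; lra.
Qed.

Lemma rat_ltM (K : archiRealFieldType) (x y : K) (q : rat) : 0 < x -> 0 < y ->
  ratr q < x * y <-> exists r : rat, [/\ 0 < r, ratr r < x & ratr (q / r) < y].
Proof.
move=> x0 y0; split=> [qxy|[r [r0 rx]]].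
  (* The rational [r] below [x] must exceed [q / y], and also 0 because [q] is divided by it. *)
  have : Num.max 0 (ratr q / y) < x by rewrite gt_max x0 ltr_pdivrMr.
  move=> /rat_in_itvoo[r]; rewrite in_itv /= gt_max => /andP[/andP[r0 qr] rx].
  move: r0; rewrite ltr0q => r0; exists r; split => //.
  by rewrite fmorph_div /= ltr_pdivrMr ?ltr0q // mulrC -ltr_pdivrMr.
rewrite fmorph_div /= ltr_pdivrMr ?ltr0q // => /lt_trans; apply.
by rewrite mulrC ltr_pM2r.
Qed.

Variables K L : realType.

Definition real_transfer (x : K) : L :=
  sup [set (ratr q : L) | q in [set q : rat | ratr q < x]].

(** This determines the transferred element by its rational cut; the algebraic properties of the
    transfer follow from it. *)
Lemma rat_lt_real_transfer (x : K) (q : rat) :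
  (ratr q < real_transfer x) = (ratr q < x).
Proof.
set E := [set (ratr q : L) | q in [set q : rat | ratr q < x]].
have [r0 rx0] : exists r : rat, ratr r < x.
  have /rat_in_itvoo[r] : x - 1 < x by lra.
  by rewrite in_itv /= => /andP[]; exists r.
have [r1 rx1] : exists r : rat, x < ratr r.
  have /rat_in_itvoo[r] : x < x + 1 by lra.
  by rewrite in_itv /= => /andP[]; exists r.
have ubE r : x <= ratr r -> ubound E (ratr r).
  by move=> xr _ [s sx <-]; rewrite ler_rat -(ler_rat K); exact/ltW/(lt_le_trans sx).
have E0 : E !=set0 by exists (ratr r0), r0.
apply/idP/idP => [|/rat_in_itvoo[s]].
  by apply: contraTT; rewrite -!leNgt => xq; apply: ge_sup => //; exact: ubE.
(* The supremum is only known to be at least each member, so a rational [s] strictly between [q] and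
   [x] gives the strict inequality. *)
rewrite in_itv /= => /andP[qs sx].
apply: (@lt_le_trans _ _ (ratr s)); first by rewrite ltr_rat -(ltr_rat K).
by apply: ub_le_sup; [exists (ratr r1); exact/ubE/ltW | exists s].
Qed.

Lemma real_transferD : {morph real_transfer : x y / x + y}.
Proof.
move=> x y; apply: rat_lt_ext => q; rewrite rat_lt_real_transfer.
apply/idP/idP => /rat_ltD[r [rx ry]]; apply/rat_ltD; exists r.
  by rewrite !rat_lt_real_transfer.
by rewrite -!rat_lt_real_transfer.
Qed.

Lemma real_transfer_rat (q : rat) : real_transfer (ratr q) = ratr q.
Proof. by apply: rat_lt_ext => r; rewrite rat_lt_real_transfer !ltr_rat. Qed.

Lemma real_transferN : {morph real_transfer : x / - x}.
Proof.
move=> x; apply/eqP; rewrite -addr_eq0 -real_transferD addNr.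
by have := real_transfer_rat 0; rewrite !rmorph0 => ->.
Qed.

Lemma real_transfer_gt0 (x : K) : (0 < real_transfer x) = (0 < x).
Proof. by have := rat_lt_real_transfer x 0; rewrite !rmorph0. Qed.

(** Rational cuts describe products of positive factors only. The other signs reduce to these by
    negation, first in the second factor, then in the first. *)
Lemma real_transferM : {morph real_transfer : x y / x * y}.
Proof.
have f0 : real_transfer 0 = 0 by have := real_transfer_rat 0; rewrite !rmorph0.
have pos x y : 0 < x -> 0 < y -> real_transfer (x * y) = real_transfer x * real_transfer y.
  move=> x0 y0; apply: rat_lt_ext => q; rewrite rat_lt_real_transfer.
  apply/idP/idP => /rat_ltM[]; rewrite ?real_transfer_gt0 // => r [r0 rx ry];
    apply/rat_ltM; rewrite ?real_transfer_gt0 //; exists r; split => //.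
  - by rewrite rat_lt_real_transfer.
  - by rewrite rat_lt_real_transfer.
  - by rewrite -rat_lt_real_transfer.
  - by rewrite -rat_lt_real_transfer.
have posl x y : 0 < x -> real_transfer (x * y) = real_transfer x * real_transfer y.
  move=> x0; have [y0|y0|->] := ltgtP y 0; [|exact: pos|by rewrite f0 !mulr0 f0].
  rewrite -[y]opprK mulrN real_transferN pos ?oppr_gt0 //.
  by rewrite [in RHS]real_transferN mulrN.
move=> x y; have [x0|x0|->] := ltgtP x 0; [|exact: posl|by rewrite f0 !mul0r f0].
rewrite -[x]opprK mulNr real_transferN posl ?oppr_gt0 //.
by rewrite [in RHS]real_transferN mulNr.
Qed.

End RealTypeIsomorphism.

(** The transfers in the two directions both preserve rational cuts, hence are inverse to each
    other. *)
Lemma realType_isomorphic (K L : realType) : field_isomorphic K L.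
Proof.
have fB : zmod_morphism (real_transfer L : K -> L).
  by move=> x y; rewrite real_transferD real_transferN.
have fM : monoid_morphism (real_transfer L : K -> L).
  split; first by have := @real_transfer_rat K L 1; rewrite !rmorph1.
  exact: real_transferM.
pose fA := GRing.isZmodMorphism.Build K L (real_transfer L) fB.
pose fR := GRing.isMonoidMorphism.Build K L (real_transfer L) fM.
pose f : {rmorphism K -> L} := HB.pack (real_transfer L : K -> L) fA fR.
exists f; exists (real_transfer K : L -> K) => x;
  by apply: rat_lt_ext => q; rewrite !rat_lt_real_transfer.
Qed.

(** * Dedekind cuts without an end point *)

Record is_gap (F : realFieldType) (A : set F) : Prop := IsGap {
  gap_nonempty : A !=set0;
  gap_proper : exists x, ~ A x;
  gap_down : forall x y, A y -> x <= y -> A x;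
  gap_no_max : forall x, A x -> exists2 y, A y & x < y;
  gap_no_min : forall x, ~ A x -> exists2 y, ~ A y & y < x
}.

(** If [x] bounded the natural numbers, the elements below some natural number would form a gap:
    they and their complement are stable under adding and subtracting 1. *)
Lemma gapless_archimedean (F : realFieldType) :
  (forall A : set F, ~ is_gap A) -> forall x : F, exists n : nat, x < n%:R.
Proof.
move=> nogap x; apply: contrapT => xn; apply: (nogap [set y | exists n : nat, y < n%:R]).
split.
- by exists 0, 1%N.
- by exists x.
- by move=> y z [n zn] yz; exists n; exact: le_lt_trans zn.
- by move=> y [n yn]; exists (y + 1); [exists n.+1; rewrite -natr1; lra | lra].
- move=> y yn; exists (y - 1); [move=> [n yn1]; apply: yn | lra].
  by exists n.+1; rewrite -natr1; lra.
Qed.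

(** The elements lying strictly below some member of [E] form the lower half of a cut. A maximum is
    excluded by density, and a minimum of the complement would be a supremum of [E]. *)
Lemma gapless_supremums (F : realFieldType) :
  (forall A : set F, ~ is_gap A) ->
  forall E : set F, has_sup E -> supremums E !=set0.
Proof.
move=> nogap E [[e0 Ee0] [u Eu]]; apply: contrapT => nosup.
apply: (nogap [set y | exists2 e, E e & y < e]); split.
- by exists (e0 - 1), e0 => //; lra.
- by exists u => -[e Ee]; rewrite ltNge Eu.
- by move=> x y [e Ee ye] xy; exists e => //; exact: le_lt_trans ye.
- move=> x [e Ee xe]; exists ((x + e) / 2); last by lra.
  by exists e => //; lra.
- move=> x xE; apply: contrapT => xmin; apply: nosup; exists x; split.
    by move=> e Ee; rewrite leNgt; apply/negP => xe; apply: xE; exists e.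
  move=> y Ey; rewrite leNgt; apply/negP => yx; apply: xmin; exists y => //.
  by move=> [e Ee]; rewrite ltNge Ey.
Qed.

Lemma gapless_field_isomorphic (F : rcfType) (L : realType) :
  (forall A : set F, ~ is_gap A) -> field_isomorphic F L.
Proof.
move=> nogap.
have arch : Num.archimedean_axiom F.
  by move=> x; exact: gapless_archimedean.
pose archF := Num.NumDomain_bounded_isArchimedean.Build F arch.
(* The richer structures are put on the carrier of [F] itself and keep its operations, so an
   isomorphism from [K] is one from [F]. *)
pose KA : archiRealFieldType := HB.pack (Num.RealClosedField.sort F) archF.
have supP (E : set KA) : has_sup E -> supremums E (supremum 0 E).
  move=> supE; rewrite /supremum ifN; last by apply/set0P; case: supE.
  by apply: xgetPex; exact: (gapless_supremums nogap).
have supub (E : set KA) : has_sup E -> ubound E (supremum 0 E) by move=> /supP[].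
have supad (E : set KA) (e : KA) : 0 < e -> has_sup E ->
    exists2 x, E x & supremum 0 E - e < x.
  move=> e0 /supP[_ lubE]; apply: contrapT => nx.
  have : supremum 0 E <= supremum 0 E - e.
    apply: lubE => x Ex; rewrite leNgt; apply/negP => ex; apply: nx.
    by exists x.
  by lra.
pose realF := ArchimedeanField_isReal.Build KA supub supad.
pose K : realType := HB.pack (Num.RealClosedField.sort F) archF realF.
exact: (realType_isomorphic K L).
Qed.

(** * Definability *)

Section Definability.
Variables (F : rcfType) (E : expansion F).
Implicit Types (e a : nat -> F) (r : nat -> nat).

Fixpoint term_rename r (t : term E) : term E :=
  match t with
  | Var i => Var E (r i)
  | Zero => Zero E
  | One => One E
  | Add t1 t2 => Add (term_rename r t1) (term_rename r t2)
  | Opp t1 => Opp (term_rename r t1)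
  | Mul t1 t2 => Mul (term_rename r t1) (term_rename r t2)
  | App s ts => App (fun i => term_rename r (ts i))
  end.

Definition rename_lift r : nat -> nat := fun i => if i is j.+1 then (r j).+1 else 0%N.

Fixpoint formula_rename r (phi : formula E) : formula E :=
  match phi with
  | Eq t1 t2 => Eq (term_rename r t1) (term_rename r t2)
  | Le t1 t2 => Le (term_rename r t1) (term_rename r t2)
  | Rel s ts => Rel (fun i => term_rename r (ts i))
  | Not psi => Not (formula_rename r psi)
  | And psi1 psi2 => And (formula_rename r psi1) (formula_rename r psi2)
  | Exists psi => Exists (formula_rename (rename_lift r) psi)
  end.

Lemma eval_rename e r (t : term E) : eval e (term_rename r t) = eval (e \o r) t.
Proof.
elim: t => //= [t1 -> t2 ->|t1 ->|t1 -> t2 ->|s ts IH] //.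
by congr finterp; apply/rowP => i; rewrite !mxE.
Qed.

Lemma holds_rename e r (phi : formula E) :
  holds e (formula_rename r phi) <-> holds (e \o r) phi.
Proof.
elim: phi e r => /= [t1 t2|t1 t2|s ts|psi IH|psi1 IH1 psi2 IH2|psi IH] e r.
- by rewrite !eval_rename.
- by rewrite !eval_rename.
- suff -> : \row_i eval e (term_rename r (ts i)) = \row_i eval (e \o r) (ts i) by [].
  by apply/rowP => i; rewrite !mxE eval_rename.
- by rewrite IH.
- by rewrite IH1 IH2.
- have lift y : scons y e \o rename_lift r = scons y (e \o r).
    by apply/funext => -[].
  by split=> -[y]; [rewrite IH lift | rewrite -lift -IH]; exists y.
Qed.

(* Free variables sit at the even indices, parameters at the odd ones. *)
Definition interleave e a : nat -> F := fun i => if odd i then a i./2 else e i./2.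

(** Predicates on assignments replace sets of row vectors, so that quantification and renaming do
    not change the dimension. [definableP] translates between the two notions. *)
Definition definable_pred (P : (nat -> F) -> Prop) : Prop :=
  exists (phi : formula E) a, forall e, P e <-> holds (interleave e a) phi.

Lemma definable_pred_ext P Q : (forall e, P e <-> Q e) ->
  definable_pred P -> definable_pred Q.
Proof. by move=> PQ [phi [a Pphi]]; exists phi, a => e; rewrite -PQ. Qed.

Lemma interleave_double e a i : interleave e a i.*2 = e i.
Proof. by rewrite /interleave odd_double doubleK. Qed.

Lemma interleave_doubleS e a i : interleave e a i.*2.+1 = a i.
Proof. by rewrite /interleave /= odd_double /= uphalf_double. Qed.

Lemma interleave_comp e a r (h : nat -> F) :
  (forall i, h (r i.*2) = e i) -> (forall i, h (r i.*2.+1) = a i) ->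
  h \o r = interleave e a.
Proof.
move=> hev hod; apply/funext => i /=; rewrite -[i]odd_double_half.
by case: (odd i); rewrite ?add1n ?add0n ?interleave_doubleS ?interleave_double.
Qed.

Lemma definable_predI P Q : definable_pred P -> definable_pred Q ->
  definable_pred (fun e => P e /\ Q e).
Proof.
move=> [phi [a Pphi]] [psi [b Qpsi]].
(* The two parameter sequences are themselves interleaved: those of [phi] take the even places among
   the parameters, those of [psi] the odd ones. *)
pose ra i := if odd i then i./2.*2.*2.+1 else i.
pose rb i := if odd i then i./2.*2.+1.*2.+1 else i.
exists (And (formula_rename ra phi) (formula_rename rb psi)), (interleave a b) => e /=.
rewrite !holds_rename Pphi Qpsi (@interleave_comp e a) ?(@interleave_comp e b) // => i;
  rewrite /ra /rb /= odd_double /= ?uphalf_double ?interleave_double //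
    interleave_doubleS ?interleave_double ?interleave_doubleS //.
Qed.

Lemma definable_predN P : definable_pred P -> definable_pred (fun e => ~ P e).
Proof. by move=> [phi [a Pphi]]; exists (Not phi), a => e /=; rewrite Pphi. Qed.

Lemma definable_predU P Q : definable_pred P -> definable_pred Q ->
  definable_pred (fun e => P e \/ Q e).
Proof.
move=> /definable_predN nP /definable_predN nQ.
apply: definable_pred_ext (definable_predN (definable_predI nP nQ)) => e.
by split=> [/not_andP[/contrapT|/contrapT]|[Pe|Qe] []]; [left|right| |].
Qed.

Lemma definable_pred_ex P : definable_pred P ->
  definable_pred (fun e => exists y, P (scons y e)).
Proof.
move=> [phi [a Pphi]].
(* [scons] moves every index up by one, whereas a free variable has to move by two and a parameter
   not at all. Hence parameters are read one place higher and variables one place lower; the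
   truncated predecessor fixes 0, the place of the bound variable. *)
pose r i := if odd i then i.+1 else i.-1.
exists (Exists (formula_rename r phi)), a => e /=.
have rE y : scons y (interleave e a) \o r = interleave (scons y e) a.
  apply: interleave_comp => [[|i] //|i]; rewrite /r /= ?negbK odd_double /=.
    exact: interleave_double.
  exact: interleave_doubleS.
by split=> -[y yP]; exists y; move: yP; rewrite holds_rename rE Pphi.
Qed.

Lemma definable_pred_rename P r : definable_pred P ->
  definable_pred (fun e => P (e \o r)).
Proof.
move=> [phi [a Pphi]].
pose r' i := if odd i then i else (r i./2).*2.
exists (formula_rename r' phi), a => e; rewrite holds_rename Pphi.
rewrite (@interleave_comp (e \o r) a r') // => i;
  by rewrite /r' /= odd_double /= ?doubleK ?interleave_double ?interleave_doubleS.
Qed.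

Lemma definable_pred_eq (t1 t2 : term E) :
  definable_pred (fun e => eval e t1 = eval e t2).
Proof.
exists (Eq (term_rename double t1) (term_rename double t2)), (fun=> 0) => e /=.
rewrite !eval_rename; suff -> : interleave e (fun=> 0) \o double = e by [].
by apply/funext => i /=; rewrite interleave_double.
Qed.

Lemma definable_pred_lt_cst i (c : F) : definable_pred (fun e => e i < c).
Proof.
exists (Not (Le (Var E 1) (Var E i.*2))), (fun=> c) => e /=.
by rewrite interleave_double (interleave_doubleS e _ 0) ltNge; split => /negP.
Qed.

Lemma definable_pred_gt_cst i (c : F) : definable_pred (fun e => c < e i).
Proof.
exists (Not (Le (Var E i.*2) (Var E 1))), (fun=> c) => e /=.
by rewrite interleave_double (interleave_doubleS e _ 0) ltNge; split => /negP.
Qed.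

Lemma definableP n (D : set 'rV[F]_n) :
  definable E D <-> definable_pred (fun e => D (\row_(i < n) e i)).
Proof.
split=> [[phi [a ->]]|[phi [a Dphi]]].
  pose r i := if (i < n)%N then i.*2 else (i - n).*2.+1.
  exists (formula_rename r phi), a => e; rewrite holds_rename /=.
  suff -> : env (\row_(i < n) e i) a = interleave e a \o r by [].
  apply/funext => i; rewrite /env /r /=; case: insubP => [j -> <-|/negbTE ->].
    by rewrite mxE interleave_double.
  by rewrite interleave_doubleS.
(* All free variables from [n] on receive the value 0, stored as the first parameter at index [n];
   the parameters of [phi] therefore start at [n.+1]. *)
pose r i := if odd i then (n + i./2).+1 else if (i./2 < n)%N then i./2 else n.
exists (formula_rename r phi), (scons 0 a).
apply/seteqP; split => x /=.
all: rewrite holds_rename (@interleave_comp (env x (fun=> 0)) a) => [|i|i].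
all: try by rewrite -Dphi; congr D; apply/rowP => i; rewrite mxE /env valK.
all: rewrite /r /env /= odd_double /= ?doubleK ?uphalf_double.
all: try by rewrite insubF ?subSn ?leq_addr ?addKn // ltnNge leqW ?leq_addr.
all: have [lt_in|le_ni] := ltnP i n; first by rewrite !insubT.
all: by rewrite !insubF ?ltnn ?subnn // ltnNge le_ni.
Qed.

Lemma definableI n (A B : set 'rV[F]_n) :
  definable E A -> definable E B -> definable E (A `&` B).
Proof. by rewrite !definableP; exact: definable_predI. Qed.

Lemma definableU n (A B : set 'rV[F]_n) :
  definable E A -> definable E B -> definable E (A `|` B).
Proof. by rewrite !definableP; exact: definable_predU. Qed.

Lemma definable0 n : definable E (set0 : set 'rV[F]_n).
Proof.
rewrite definableP.
apply: definable_pred_ext (definable_predN (definable_pred_eq (Zero E) (Zero E))).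
by move=> e /=; split => //; apply.
Qed.

Lemma definableT n : definable E (setT : set 'rV[F]_n).
Proof.
by rewrite definableP; apply: definable_pred_ext (definable_pred_eq (Zero E) (Zero E)).
Qed.

Lemma definable_fin_bigcup n : fin_bigcup_closed (@definable F E n).
Proof. by apply/fin_bigcup_closedP; split; [exact: definable0|exact: definableU]. Qed.

Lemma definable_open_box (a b : 'rV[F]_1) : definable E (open_box a b).
Proof.
rewrite definableP; apply: definable_pred_ext
  (definable_predI (definable_pred_gt_cst 0 (a 0 0)) (definable_pred_lt_cst 0 (b 0 0))) => e.
rewrite /open_box /=; split => [[ae eb] i|/(_ 0)]; first by rewrite ord1 mxE ae eb.
by rewrite mxE => /andP[].
Qed.

Lemma graph_on_rowE n (U : set 'rV[F]_n) (f : 'rV[F]_n -> F) e :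
  graph_on U f (\row_(i < n + 1) e i) <->
  U (\row_(i < n) e i) /\ e n = f (\row_(i < n) e i).
Proof.
set x := \row_(i < n) e i; have rowE : \row_(i < n + 1) e i = row_mx x (const_mx (e n)).
  apply/rowP => i; rewrite mxE; case: (split_ordP i) => j ->.
    by rewrite row_mxEl mxE.
  by rewrite row_mxEr mxE ord1 /= addn0.
rewrite rowE; split => [[y Uy /eq_row_mx[<- /rowP/(_ 0)]]|[Ux ->]]; last by exists x.
by rewrite !mxE => <-.
Qed.

Lemma definable_graphP n (U : set 'rV[F]_n) (f : 'rV[F]_n -> F) :
  definable E (graph_on U f) <->
  definable_pred (fun e => U (\row_(i < n) e i) /\ e n = f (\row_(i < n) e i)).
Proof.
by rewrite definableP; split; apply: definable_pred_ext => e; rewrite graph_on_rowE.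
Qed.

Lemma definable_graph1 n (U : set 'rV[F]_n) :
  definable E U -> definable E (graph_on U (fun=> 1)).
Proof.
rewrite definableP definable_graphP => Udef; apply: definable_predI => //.
exact: (definable_pred_eq (Var E n) (One E)).
Qed.

Lemma definable_graph_restrict n (U V : set 'rV[F]_n) (f : 'rV[F]_n -> F) :
  definable E V -> V `<=` U -> definable E (graph_on U f) -> definable E (graph_on V f).
Proof.
rewrite definableP !definable_graphP => Vdef VU fdef.
apply: definable_pred_ext (definable_predI Vdef fdef) => e.
by split=> [[Ve []]|[Ve ?]] //; split=> //; split=> //; exact: VU.
Qed.

(** The values of [f] and [g] are introduced as two existentially quantified variables. *)
Lemma definable_graph_op n (U : set 'rV[F]_n) (f g : 'rV[F]_n -> F) (op : F -> F -> F) :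
  definable_pred (fun e => e 0%N = op (e 1%N) (e 2%N)) ->
  definable E (graph_on U f) -> definable E (graph_on U g) ->
  definable E (graph_on U (fun x => op (f x) (g x))).
Proof.
rewrite !definable_graphP => opdef fdef gdef.
(* Under the two quantifiers, index 1 holds the value of [f], index 0 that of [g], and the outer
   variables are shifted by two. *)
pose rf i := if (i < n)%N then i.+2 else 1%N.
pose rg i := if (i < n)%N then i.+2 else 0%N.
pose ro i := nth 0%N [:: n.+2; 1; 0]%N i.
have := definable_pred_ex (definable_pred_ex
  (definable_predI (definable_pred_rename rf fdef)
    (definable_predI (definable_pred_rename rg gdef) (definable_pred_rename ro opdef)))).
apply: definable_pred_ext => e.
have rfE y z : \row_(i < n) (scons z (scons y e) \o rf) i = \row_(i < n) e i.
  by apply/rowP => i; rewrite !mxE /= /rf ltn_ord.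
have rgE y z : \row_(i < n) (scons z (scons y e) \o rg) i = \row_(i < n) e i.
  by apply/rowP => i; rewrite !mxE /= /rg ltn_ord.
split=> [[y [z]]|[Ue en]].
  by rewrite rfE rgE /rf /rg /= ltnn /= => -[[Ue <-] [[_ <-] ->]].
exists (f (\row_(i < n) e i)), (g (\row_(i < n) e i)).
by rewrite rfE rgE /rf /rg /= ltnn.
Qed.

End Definability.

(** * Localization of a space at a family of open sets *)

Lemma fam_unionIr T (C : set (set T)) (V : set T) :
  fam_union [set U `&` V | U in C] = fam_union C `&` V.
Proof. by rewrite /fam_union bigcup_image setI_bigcupl. Qed.

Lemma fam_unionIl T (C : set (set T)) (V : set T) :
  fam_union [set V `&` U | U in C] = V `&` fam_union C.
Proof. by rewrite /fam_union bigcup_image setI_bigcupr. Qed.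

Lemma fam_union_bigcup T (C : set (set T)) (D : set T -> set (set T)) :
  (forall U, C U -> fam_union (D U) = U) ->
  fam_union (\bigcup_(U in C) D U) = fam_union C.
Proof. by move=> DU; rewrite /fam_union bigcup_bigcup; exact: eq_bigcupr. Qed.

Section Localization.
Variables (F : rcfType) (T : pointedType) (M : space_over F T).
Hypothesis Mspace : is_space M.

Let Mgts : is_gts M := space_gts Mspace.

Lemma gopenI U V : gopen M U -> gopen M V -> gopen M (U `&` V).
Proof. by move=> Uo Vo; have [] := gts_A2 Mgts Uo Vo. Qed.

Lemma gopenU U V : gopen M U -> gopen M V -> gopen M (U `|` V).
Proof. by move=> Uo Vo; have [] := gts_A2 Mgts Uo Vo. Qed.

(** Axiom A5 asks for an open subset of the union, so it is applied to the intersection of [V] with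
    the union. *)
Lemma admissible_trace C V : admissible M C -> gopen M V ->
  admissible M [set U `&` V | U in C].
Proof.
move=> Cadm Vo; have CV := gopenI (gts_A4 Mgts Cadm) Vo.
have := gts_A5 Mgts Cadm CV (@subIsetl _ _ _).
congr admissible; apply/seteqP; split=> _ [U CU <-]; exists U => //;
  by rewrite setIAC (setIidr (bigcup_sup CU)).
Qed.

Lemma sect_trace U V f : gopen M V -> sect M U f -> sect M (U `&` V) f.
Proof.
move=> Vo Uf; have Uo := sect_open Mspace Uf.
by apply: (sect_restrict Mspace _ _ Uf); [exact: gopenI|exact: subIsetl].
Qed.

Lemma open_subspace_is_space B : gopen M B -> is_space (open_subspace M B).
Proof.
move=> Bo; split; last first.
- move=> C s [Cadm CB] sC sE.
  have [f fsect fE] := sect_glue Mspace Cadm (fun U CU => (sC U CU).2) sE.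
  by exists f => //; split=> // x [U CU Ux]; exact: CB CU _ Ux.
- move=> U V f [Vo VB] VU [UB Uf]; split => //.
  exact: (sect_restrict Mspace Vo VU Uf).
- by move=> U f g [UB Uf] [_ Ug]; split => //; exact: (sect_mul Mspace Uf Ug).
- by move=> U f g [UB Uf] [_ Ug]; split => //; exact: (sect_sub Mspace Uf Ug).
- by move=> U [Uo UB]; split=> //; exact: (sect_one Mspace Uo).
- by move=> U f g [UB Uf] fg; split=> //; exact: (sect_sat Mspace Uf fg).
- by move=> U f [UB Uf]; split => //; exact: (sect_open Mspace Uf).
have open_union C : admissible M C -> (forall V, C V -> V `<=` B) -> fam_union C `<=` B.
  by move=> _ CB x [U CU Ux]; exact: CB CU _ Ux.
split.
- by move=> U [].
- by move=> C [Cadm CB] U CU; split; [exact: (gts_adm_open Mgts Cadm CU)|exact: CB].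
- by split; split=> //; exact: (gts_A1 Mgts).1.
- move=> U V [Uo UB] [Vo VB]; split; split.
  + exact: gopenU.
  + by rewrite subUset.
  + exact: gopenI.
  + by move=> x [/UB].
- move=> C Cfin Copen; split; first by apply: (gts_A3 Mgts) => // U /Copen[].
  by move=> U /Copen[].
- by move=> C [Cadm CB]; split; [exact: (gts_A4 Mgts Cadm)|exact: open_union].
- move=> C V [Cadm CB] [Vo VB] VC; split; first exact: (gts_A5 Mgts Cadm Vo VC).
  by move=> _ [U CU <-] x [/VB].
- move=> C D [Cadm CB] CD; split.
    by apply: (gts_A6 Mgts) => // U CU; have [[]] := CD U CU.
  by move=> V [U CU DV]; have [[_ DB] _] := CD U CU; exact: DB.
- move=> C D Copen [Dadm DB] DC Dref; split; last by move=> U /Copen[].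
  by apply: (gts_A7 Mgts _ Dadm DC Dref) => U /Copen[].
- move=> C V [Cadm CB] VC CV; split.
    by apply: (gts_A8 Mgts Cadm VC _) => U /CV[].
  by move=> x /VC[U CU Ux]; exact: CB CU _ Ux.
Qed.

(* The finest space having the members of [Bs] as open subspaces. *)
Definition localization (Bs : set (set T)) : space_over F T :=
  let lopen U := U `<=` carrier M /\ forall B, Bs B -> gopen M (U `&` B) in
  {| carrier := carrier M;
     gopen := lopen;
     admissible := [set C | C `<=` lopen /\
       forall B, Bs B -> admissible M [set U `&` B | U in C]];
     sect := fun U => [set f | lopen U /\ forall B, Bs B -> sect M (U `&` B) f] |}.

Variable Bs : set (set T).
Hypothesis Bs_open : Bs `<=` gopen M.

Let N := localization Bs.

(** Each axiom is checked on the traces on a member of [Bs], since traces commute with unions and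
    intersections. Only A6 needs a choice. *)
Lemma localization_gts : is_gts N.
Proof.
split.
- by move=> U [].
- by move=> C [].
- have [g0 gM] := gts_A1 Mgts; split; split=> // B BsB; first by rewrite set0I.
  by apply: gopenI => //; exact: Bs_open.
- move=> U V [UM Uo] [VM Vo]; split; split.
  + by rewrite subUset.
  + by move=> B BsB; rewrite setIUl; apply: gopenU; [exact: Uo|exact: Vo].
  + by move=> x [/UM].
  + by move=> B BsB; rewrite setIIl; apply: gopenI; [exact: Uo|exact: Vo].
- move=> C Cfin Copen; split=> // B BsB; apply: (gts_A3 Mgts); first exact: finite_image.
  by move=> _ [U CU <-]; exact: (Copen U CU).2.
- move=> C [Copen Cadm]; split; first by move=> x [U /Copen[UM _] /UM].
  by move=> B BsB; rewrite -fam_unionIr; exact: (gts_A4 Mgts (Cadm B BsB)).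
- move=> C V [Copen Cadm] [VM Vo] VC; split.
    move=> _ [U CU <-]; split; first by move=> x [/VM].
    by move=> B BsB; rewrite setIIl; apply: gopenI; [exact: Vo|exact: (Copen U CU).2].
  move=> B BsB; have := gts_A5 Mgts (Cadm B BsB) (Vo B BsB).
  rewrite fam_unionIr => /(_ (setSI VC)); congr admissible.
  rewrite !image_comp; apply: eq_imagel => U _ /=.
  by rewrite -setIIl.
- move=> C D [Copen Cadm] CD; split.
    by move=> V [U CU DV]; exact: (CD U CU).1.1 _ DV.
  move=> B BsB.
  (* Different members of [C] may have the same trace on [B], so one member [u X] is chosen for
     every trace [X]. *)
  have /choice[u uP] : forall X, exists V,
      [set U `&` B | U in C] X -> C V /\ V `&` B = X.
    move=> X; case: (pselect ([set U `&` B | U in C] X)) => [[U CU <-]|nX].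
      by exists U.
    by exists X => trX; case: nX.
  pose D' X := [set W `&` B | W in D (u X)].
  have D'P X : [set U `&` B | U in C] X -> admissible M (D' X) /\ fam_union (D' X) = X.
    move=> /uP[CX uX]; have [[_ Dadm] DX] := CD _ CX.
    by split; [exact: Dadm|rewrite fam_unionIr DX].
  (* The chosen members yield only part of the required family, but with the same union; A7 extends
     admissibility from it to the whole family. *)
  apply: (gts_A7 Mgts _ (gts_A6 Mgts (Cadm B BsB) D'P) _ _).
  + move=> _ [V [U CU DV] <-]; exact: ((CD U CU).1.1 _ DV).2.
  + rewrite fam_unionIr (fam_union_bigcup (fun U CU => (CD U CU).2)) -fam_unionIr.
    exact: (fam_union_bigcup (fun U CU => (D'P U CU).2)).
  + move=> _ [X /uP[CX _] [W DW <-]]; exists (W `&` B) => //.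
    by exists W => //; exists (u X).
- move=> C D Copen [Dopen Dadm] DC Dref; split=> // B BsB.
  apply: (gts_A7 Mgts _ (Dadm B BsB) _ _).
  + by move=> _ [U CU <-]; exact: (Copen U CU).2.
  + by rewrite !fam_unionIr DC.
  + move=> _ [V DV <-]; have [U CU VU] := Dref V DV.
    by exists (U `&` B); [exists U|exact: setSI].
- move=> C V [Copen Cadm] VC CV; split.
    by move=> x /VC[U /Copen[UM _] /UM].
  move=> B BsB; apply: (gts_A8 Mgts (Cadm B BsB) _ _).
    by rewrite fam_unionIr; exact: setSI.
  by move=> _ [U CU <-]; rewrite -setIIl; exact: (CV U CU).2.
Qed.

Lemma localization_is_space : is_space N.
Proof.
split; first exact: localization_gts.
- by move=> U f [].
- move=> U f g [Uo Uf] fg; split=> // B BsB.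
  apply: (sect_sat Mspace (Uf B BsB) _) => x; rewrite in_setI => /andP[xU _].
  exact: fg.
- by move=> U Uo; split=> // B BsB; apply: (sect_one Mspace); exact: Uo.2.
- move=> U f g [Uo Uf] [_ Ug]; split=> // B BsB.
  exact: (sect_sub Mspace (Uf B BsB) (Ug B BsB)).
- move=> U f g [Uo Uf] [_ Ug]; split=> // B BsB.
  exact: (sect_mul Mspace (Uf B BsB) (Ug B BsB)).
- move=> U V f Vo VU [Uo Uf]; split=> // B BsB.
  by apply: (sect_restrict Mspace _ _ (Uf B BsB)); [exact: Vo.2|exact: setSI].
- move=> C s Cadm sC sE.
  have /choice[u uP] : forall x, exists U, fam_union C x -> C U /\ U x.
    move=> x; case: (pselect (fam_union C x)) => [[U CU Ux]|nx].
      by exists U.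
    by exists set0 => Cx; case: nx.
  pose f x := s (u x) x.
  have fE U : C U -> {in U, f =1 s U}.
    move=> CU x /set_mem Ux; have [|Cx uxx] := uP x; first by exists U.
    by apply: sE => //; rewrite in_setI !mem_set.
  exists f => //; split; first exact: (gts_A4 localization_gts Cadm).
  move=> B BsB; rewrite -fam_unionIr.
  (* On [B] the section of a trace is that of a chosen member of [C] with this trace. The sheaf
     property of [M] glues these to some [g], which agrees with [f] on the trace of the union. *)
  have /choice[v vP] : forall X, exists V,
      [set U `&` B | U in C] X -> C V /\ V `&` B = X.
    move=> X; case: (pselect ([set U `&` B | U in C] X)) => [[U CU <-]|nX].
      by exists U.
    by exists X => trX; case: nX.
  have [||g gsect gE] := sect_glue Mspace (s := s \o v) (Cadm.2 B BsB).
  + by move=> X /vP[CX vX]; have := (sC _ CX).2 B BsB; rewrite vX.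
  + move=> X Y /vP[CX vX] /vP[CY vY] x; rewrite in_setI => /andP[xX xY] /=.
    apply: sE => //; rewrite in_setI; apply/andP; split; apply/mem_set.
      by move: (set_mem xX); rewrite -{1}vX => -[].
    by move: (set_mem xY); rewrite -{1}vY => -[].
  apply: (sect_sat Mspace gsect _) => x /set_mem[X trX Xx].
  rewrite (gE X trX); last exact: mem_set.
  have [CX vX] := vP X trX; rewrite /= (fE _ CX) //.
  by apply: mem_set; move: Xx; rewrite -{1}vX => -[].
Qed.

Lemma localization_open U : gopen M U -> gopen N U.
Proof.
by move=> Uo; split=> [|B /Bs_open Bo]; [exact: (gts_sub Mgts Uo)|exact: gopenI].
Qed.

(** A subset of [B] is its own trace on [B], so what holds in [N] holds in [M]. Conversely, traces
    on open sets preserve openness, admissibility and sections. *)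
Lemma open_subspace_localization B : Bs B ->
  open_subspace N B = open_subspace M B.
Proof.
move=> BsB; have openE U : U `<=` B -> gopen N U <-> gopen M U.
  move=> UB; split=> [[_ /(_ B BsB)]|]; last exact: localization_open.
  by rewrite (setIidl UB).
rewrite /open_subspace; congr SpaceOver.
- by apply/seteqP; split=> U [Uo UB]; split=> //; apply/openE.
- apply/seteqP; split=> C [Cadm CB]; split=> //.
    have := Cadm.2 B BsB; rewrite (@eq_imagel _ _ C _ id) ?image_id //.
    by move=> U /CB /setIidl.
  split=> [U CU|B' /Bs_open B'o]; last exact: admissible_trace.
  by apply: localization_open; exact: (gts_adm_open Mgts Cadm CU).
- apply/funext => U; apply/seteqP; split=> f [UB Uf]; split=> //.
    by have := Uf.2 B BsB; rewrite (setIidl UB).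
  split=> [|B' /Bs_open B'o]; last exact: sect_trace.
  by apply: localization_open; exact: (sect_open Mspace Uf).
Qed.

(** Among the traces of [Bs] on [B] is [B] itself, so they are refined by the family with the single
    member [B]. *)
Lemma localization_admissible : admissible N Bs.
Proof.
split=> [U /Bs_open|B BsB]; first exact: localization_open.
have Bo := Bs_open BsB.
apply: (gts_A7 Mgts (D := [set B]) _ _ _ _).
- by move=> _ [B' /Bs_open B'o <-]; exact: gopenI.
- by apply: (gts_A3 Mgts) => [|_ ->]; first exact: finite_set1.
- rewrite fam_unionIr /fam_union bigcup_set1; apply/esym/setIidr.
  exact: bigcup_sup.
- by move=> _ ->; exists B => //; exists B => //; rewrite setIid.
Qed.

End Localization.

Lemma space_isomorphic_refl (F : rcfType) (T : pointedType) (M : space_over F T) :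
  is_space M -> space_isomorphic M M.
Proof.
move=> Mspace; have Mgts := space_gts Mspace.
have preimE U : gopen M U -> space_preim M id U = U.
  by move=> Uo; apply/setIidr; exact: (gts_sub Mgts Uo).
have idM : space_morphism M M id.
  split=> // [C Cadm|V h Vo Vh]; last by rewrite preimE.
  rewrite (@eq_imagel _ _ C _ id) ?image_id // => U CU.
  by apply: preimE; exact: (gts_adm_open Mgts Cadm CU).
by exists id, id.
Qed.

(** * Definable sets as spaces *)

Section DefinableSetSpace.
Variables (F : rcfType) (E : expansion F) (n : nat) (D : set 'rV[F]_n).
Hypothesis Ddef : definable E D.
Implicit Types (U V : set 'rV[F]_n) (C : set (set 'rV[F]_n)).

Lemma within_continuousP U (f : 'rV[F]_n -> F) :
  {within U, continuous f} <-> (forall x, U x -> f @ within U (nbhs x) --> f x).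
Proof. exact: subspace_continuousP. Qed.

Lemma definable_open_sub U : definable_open E D U -> U `<=` D.
Proof. by move=> [_ [W _ ->]]; exact: subIsetl. Qed.

Lemma definable_openI U V :
  definable_open E D U -> definable_open E D V -> definable_open E D (U `&` V).
Proof.
move=> [Udef [W Wo UW]] [Vdef [W' W'o VW']]; split; first exact: definableI.
by exists (W `&` W'); [exact: openI|rewrite UW VW' setIACA setIid].
Qed.

Lemma definable_openU U V :
  definable_open E D U -> definable_open E D V -> definable_open E D (U `|` V).
Proof.
move=> [Udef [W Wo UW]] [Vdef [W' W'o VW']]; split; first exact: definableU.
by exists (W `|` W'); [exact: openU|rewrite UW VW' setIUr].
Qed.

Lemma definable_open0 : definable_open E D set0.
Proof.
by split; [exact: definable0|exists set0; [exact: open0|rewrite setI0]].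
Qed.

Lemma definable_open_fin_bigcup : fin_bigcup_closed (definable_open E D).
Proof. by apply/fin_bigcup_closedP; split; [exact: definable_open0|exact: definable_openU]. Qed.

(** Admissible families are replaced by finite subcovers, and definable open sets are closed under
    finite unions. *)
Lemma definable_set_gts : is_gts (definable_set_space E D).
Proof.
split => /=.
- exact: definable_open_sub.
- by move=> C [].
- split; first exact: definable_open0.
  by split=> //; exists setT; [exact: openT|rewrite setIT].
- by move=> U V Uo Vo; split; [exact: definable_openU|exact: definable_openI].
- by move=> C Cfin Co; split=> //; exists C; split.
- move=> C [Co [C' [C'C C'fin <-]]].
  by apply: definable_open_fin_bigcup => // U /C'C /Co.
- move=> C V [Co [C' [C'C C'fin C'E]]] Vo VC; split.
    by move=> _ [U CU <-]; apply: definable_openI => //; exact: Co.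
  exists [set V `&` U | U in C']; split; first exact: image_subset.
    exact: finite_image.
  by rewrite !fam_unionIl C'E.
- move=> C G [Co [C' [C'C C'fin C'E]]] CG; split.
    by move=> V [U CU GV]; exact: (CG U CU).1.1 _ GV.
  have /choice[H HP] : forall U, exists H, C U ->
      [/\ H `<=` G U, finite_set H & fam_union H = U].
    move=> U; case: (pselect (C U)) => CU; last by exists set0.
    by have [[_ [H [HG Hfin HE]]] GE] := CG U CU; exists H; rewrite HE GE.
  exists (\bigcup_(U in C') H U); split.
  + by move=> V [U /C'C CU HV]; exists U => //; have [HG _ _] := HP U CU; exact: HG.
  + by apply: bigcup_finite => // U /C'C /HP[].
  + rewrite !fam_union_bigcup // => [U CU|U /C'C /HP[] //].
    exact: (CG U CU).2.
- move=> C G Co [Go [G' [G'G G'fin G'E]]] GC Gref; split=> //.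
  have /choice[u uP] : forall V, exists U, G V -> C U /\ V `<=` U.
    move=> V; case: (pselect (G V)) => [/Gref[U CU VU]|nGV]; first by exists U.
    by exists set0.
  exists (u @` G'); split; first by move=> _ [V /G'G /uP[CV _] <-].
    exact: finite_image.
  apply/seteqP; split=> x.
    by move=> [_ [V /G'G /uP[CV _] <-] xV]; exists (u V).
  rewrite -GC -G'E => -[V G'V Vx]; exists (u V); first by exists V.
  by have [_] := uP V (G'G V G'V); apply.
- move=> C V [Co [C' [C'C C'fin C'E]]] VC CV.
  rewrite -(setIidl VC) -C'E /fam_union setI_bigcupr.
  by apply: definable_open_fin_bigcup => // U /C'C /CV.
Qed.

Lemma definable_pred_sub : definable_pred E (fun e => e 0%N = e 1%N - e 2%N).
Proof. exact: (definable_pred_eq (Var E 0) (Add (Var E 1) (Opp (Var E 2)))). Qed.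

Lemma definable_pred_mul : definable_pred E (fun e => e 0%N = e 1%N * e 2%N).
Proof. exact: (definable_pred_eq (Var E 0) (Mul (Var E 1) (Var E 2))). Qed.

(** Continuity is local. Definability is not, but by admissibility the graph is a finite union of
    graphs of the given sections. *)
Lemma definable_sect_glue C (s : set 'rV[F]_n -> 'rV[F]_n -> F) (f : 'rV[F]_n -> F) :
  admissible (definable_set_space E D) C ->
  (forall U, C U -> sect (definable_set_space E D) U (s U)) ->
  (forall U, C U -> {in U, f =1 s U}) ->
  sect (definable_set_space E D) (fam_union C) f.
Proof.
move=> Cadm sC fE; have uo := gts_A4 definable_set_gts Cadm.
have [Co [C' [C'C C'fin C'E]]] := Cadm.
split=> //.
  apply/within_continuousP => x [U CU Ux].
  have [[_ [W Wo UW]] /within_continuousP scont _] := sC U CU.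
  rewrite (fE U CU) ?inE // => P /(scont x Ux) sP.
  have Wx : W x by move: Ux; rewrite UW => -[].
  have sPx : nbhs x [set y | U y -> P (s U y)] by exact: sP.
  suff : nbhs x [set y | fam_union C y -> P (f y)] by [].
  apply: filterS (filterI sPx (open_nbhs_nbhs (conj Wo Wx))) => y [sPy Wy] Cy.
  (* Within [W] the union of [C] lies in [U], because it is contained in [D] and [U] is the trace of
     [W] on [D]. *)
  have Uy : U y by rewrite UW; split=> //; exact: definable_open_sub uo _ Cy.
  by rewrite /= (fE U CU) ?inE //; exact: sPy.
suff -> : graph_on (fam_union C) f = \bigcup_(U in C') graph_on U (s U).
  by apply: definable_fin_bigcup => // U /C'C /sC[].
rewrite -C'E; apply/seteqP; split=> z.
  move=> [x [U C'U Ux] <-]; exists U => //; exists x => //.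
  by rewrite (fE U (C'C U C'U)) ?inE.
move=> [U C'U [x Ux <-]]; exists x; first by exists U.
by rewrite (fE U (C'C U C'U)) ?inE.
Qed.

Lemma definable_set_is_space : is_space (definable_set_space E D).
Proof.
split; first exact: definable_set_gts.
- by move=> U f [].
- move=> U f g [Uo fcont fdef] fg; split=> //.
    exact: subspace_eq_continuous fcont.
  suff -> : graph_on U g = graph_on U f by [].
  by apply: eq_imagel => x Ux; rewrite fg ?inE.
- move=> U Uo; split=> //; last by apply: definable_graph1; case: Uo.
  by apply: continuous_subspaceT; exact: cst_continuous.
- move=> U f g [Uo /within_continuousP fcont fdef] [_ /within_continuousP gcont gdef].
  split=> //; last exact: (definable_graph_op (op := fun x y => x - y) definable_pred_sub).
  by apply/within_continuousP => x Ux; apply: cvgB; [exact: fcont|exact: gcont].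
- move=> U f g [Uo /within_continuousP fcont fdef] [_ /within_continuousP gcont gdef].
  split=> //; last exact: (definable_graph_op (op := fun x y => x * y) definable_pred_mul).
  by apply/within_continuousP => x Ux; apply: cvgM; [exact: fcont|exact: gcont].
- move=> U V f Vo VU [_ fcont fdef]; split=> //.
    exact: continuous_subspaceW fcont.
  by apply: definable_graph_restrict fdef => //; case: Vo.
- move=> C s Cadm sC sE.
  have /choice[u uP] : forall x, exists U, fam_union C x -> C U /\ U x.
    move=> x; case: (pselect (fam_union C x)) => [[U CU Ux]|nx]; first by exists U.
    by exists set0.
  pose f x := s (u x) x.
  have fE U : C U -> {in U, f =1 s U}.
    move=> CU x /set_mem Ux; have [|Cx uxx] := uP x; first by exists U.
    by apply: sE => //; rewrite in_setI !mem_set.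
  by exists f => //; exact: (definable_sect_glue Cadm sC fE).
Qed.

Lemma open_subspace_definable_set B : definable_open E D B ->
  open_subspace (definable_set_space E D) B = definable_set_space E B.
Proof.
move=> Bo; have BD := definable_open_sub Bo; have [Bdef [W0 W0o BW0]] := Bo.
have openE U : definable_open E B U <-> definable_open E D U /\ U `<=` B.
  split=> [[Udef [W Wo UW]]|[[Udef [W Wo UW]] UB]].
    split; last by rewrite UW; exact: subIsetl.
    split=> //; exists (W0 `&` W); first exact: openI.
    by rewrite setIA -BW0.
  split=> //; exists W => //; rewrite UW; apply/seteqP; split=> x [].
    by move=> Dx Wx; split=> //; apply: UB; rewrite UW.
  by move=> /BD.
rewrite /open_subspace /definable_set_space; congr SpaceOver.
- by apply/seteqP; split=> U; rewrite openE.
- apply/seteqP; split=> C.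
    by move=> [[Co Cfin] CB]; split=> // U CU; rewrite openE; split; [exact: Co|exact: CB].
  move=> [Co Cfin]; split; first by split=> // U /Co /openE[].
  by move=> U /Co /openE[].
- apply/funext => U; apply/seteqP; split=> f.
    by move=> [UB [Uo fcont fdef]]; split=> //; rewrite openE.
  by move=> [/openE[Uo UB] fcont fdef].
Qed.

End DefinableSetSpace.

(** * Gaps and o-minimality *)

Section Gaps.
Variable F : realFieldType.
Implicit Type A : set F.

Lemma gap_shift A (e : F) : is_gap A -> is_gap [set x | A (x - e)].
Proof.
move=> [[a Aa] [b Ab] Adown Amax Amin]; split => /=.
- by exists (a + e); rewrite /= addrK.
- by exists (b + e); rewrite addrK.
- by move=> x y /Adown Ay xy; apply: Ay; rewrite lerD2r.
- by move=> x /Amax[y Ay xy]; exists (y + e); rewrite ?addrK // -ltrBlDr.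
- by move=> x /Amin[y Ay xy]; exists (y + e); rewrite ?addrK // -ltrBrDr.
Qed.

Lemma gap_lt A (x y : F) : is_gap A -> A x -> ~ A y -> x < y.
Proof. by move=> Agap Ax Ay; rewrite ltNge; apply/negP => /(gap_down Agap Ax). Qed.

Definition constant_near_gap A (P : F -> bool) : Prop :=
  exists u v, [/\ A u, ~ A v &
    forall x y, u < x < v -> u < y < v -> P x = P y].

Lemma constant_near_gap2 A (op : bool -> bool -> bool) (P Q : F -> bool) :
  constant_near_gap A P -> constant_near_gap A Q ->
  constant_near_gap A (fun x => op (P x) (Q x)).
Proof.
move=> [u [v [Au Av uvP]]] [u' [v' [Au' Av' uvQ]]].
exists (Num.max u u'), (Num.min v v'); split.
- by case: (leP u u').
- by case: (leP v v').
- move=> x y; rewrite !gt_max !lt_min.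
  move=> /andP[/andP[ux u'x] /andP[xv xv']] /andP[/andP[uy u'y] /andP[yv yv']].
  by rewrite (uvP x y) ?ux ?uy // (uvQ x y) ?u'x ?u'y.
Qed.

Lemma constant_near_gap_cst A b : is_gap A -> constant_near_gap A (fun=> b).
Proof. by case=> [[u Au] [v Av] _ _ _]; exists u, v. Qed.

(** The point [z] lies on one side of the gap, and there it serves as the end point of the
    neighbourhood. *)
Lemma constant_near_gap_lt A z : is_gap A -> constant_near_gap A (fun x => x < z).
Proof.
move=> [[u Au] [v Av] _ _ _]; have [Az|Az] := pselect (A z).
  exists z, v; split=> // x y /andP[zx _] /andP[zy _].
  by rewrite !ltNge (ltW zx) (ltW zy).
by exists u, z; split=> // x y /andP[_ ->] /andP[_ ->].
Qed.

Lemma constant_near_gap_le A z : is_gap A -> constant_near_gap A (fun x => x <= z).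
Proof.
move=> [[u Au] [v Av] _ _ _]; have [Az|Az] := pselect (A z).
  by exists z, v; split=> // x y /andP[zx _] /andP[zy _]; rewrite !leNgt zx zy.
by exists u, z; split=> // x y /andP[_ /ltW ->] /andP[_ /ltW ->].
Qed.

Lemma constant_near_gap_itv A (i : interval F) :
  is_gap A -> constant_near_gap A (fun x => x \in i).
Proof.
move=> Agap; case: i => l r; apply: (@constant_near_gap2 _ andb).
  case: l => [[] z|[]]; try exact: constant_near_gap_cst.
  - have [u [v [Au Av uv]]] := constant_near_gap_lt z Agap.
    by exists u, v; split=> // x y xuv yuv; rewrite !bnd_simp !leNgt (uv x y).
  - have [u [v [Au Av uv]]] := constant_near_gap_le z Agap.
    by exists u, v; split=> // x y xuv yuv; rewrite !bnd_simp !ltNge (uv x y).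
case: r => [[] z|[]]; try exact: constant_near_gap_cst.
- exact: constant_near_gap_lt.
- exact: constant_near_gap_le.
Qed.

(** This is the form in which o-minimality is used: a finite union of intervals has its end points
    in [F] or at infinity, so it cannot change at a gap. *)
Lemma constant_near_gap_has A (s : seq (interval F)) :
  is_gap A -> constant_near_gap A (fun x => has (fun i => x \in i) s).
Proof.
move=> Agap; elim: s => [|i s IH]; first exact: constant_near_gap_cst.
exact: (constant_near_gap2 orb (constant_near_gap_itv i Agap) IH).
Qed.

(* Translating a gap by the multiples of a length that moves it gives gaps that
   accumulate at no point, and any two of which are separated. *)
Lemma exists_gap_sequence A : is_gap A ->
  exists G : nat -> set F, [/\ forall n, is_gap (G n),
    forall x, exists u v, u < x < v /\
      forall n y z, u < y < v -> u < z < v -> G n y -> G n z &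
    forall n, exists p q, [/\ G n p, ~ G n q & forall m, m <> n -> G m p <-> G m q]].
Proof.
move=> Agap; have [[a Aa] [b Ab] Adown _ _] := Agap.
have ab := gap_lt Agap Aa Ab; pose e := b - a.
have e0 : 0 < e by rewrite subr_gt0.
pose G n := [set x | A (x - e *+ n)].
have Ggap n : is_gap (G n) by exact: gap_shift.
have Gmono m n x : (m <= n)%N -> G m x -> G n x.
  move=> mn; rewrite /G /= => /Adown; apply.
  by rewrite lerB // ler_wpMn2l // ltW.
exists G; split=> // [x|n].
  have [[n Gnx]|nG] := pselect (exists n, G n x); last first.
    (* If [x] is above all the gaps, so is every point above [x - e], since a translation by [e]
       leads from [G n] to [G n.+1]. *)
    exists (x - e), (x + 1); split=> [|n y z /andP[xy _] _ Gny]; first by lra.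
    case: nG; exists n.+1; apply: Adown Gny _.
    by rewrite mulrSr opprD addrA addrAC; lra.
  (* With [k] least, the gaps before the [k]-th lie below [x] and the others above. The last gap
     below [x] bounds the choice of [u], the first one above it that of [v]. *)
  have [k Gkx kmin] : exists2 k, G k x & forall m, (m < k)%N -> ~ G m x.
    have ex : exists n, `[< G n x >] by exists n; apply/asboolP.
    exists (ex_minn ex); case: ex_minnP => k /asboolP Gkx kmin //.
    by move=> m mk Gmx; move: mk; rewrite ltnNge kmin //; exact/asboolP.
  have [v Gv xv] := gap_no_max (Ggap k) Gkx.
  have [u ux uG] : exists2 u, u < x & forall m, (m < k)%N -> ~ G m u.
    case: k kmin {Gkx v Gv xv} => [|k] kmin; first by exists (x - 1) => //; lra.
    have [u Gu ux] := gap_no_min (Ggap k) (kmin k (ltnSn k)).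
    by exists u => // m mk Gmu; apply: Gu; exact: Gmono Gmu.
  exists u, v; split=> [|n' y z /andP[uy yv] /andP[uz zv] Gny]; first by rewrite ux.
  have [n'k|kn'] := ltnP n' k.
    by case: (uG n' n'k); exact: (gap_down (Ggap n') Gny (ltW uy)).
  by apply: Gmono kn' _; exact: (gap_down (Ggap k) Gv (ltW zv)).
(* These points are one step [e] apart and enclose the [n]-th gap. Translated back by [e *+ m], both
   are at least [b] if [m < n] and at most [a] if [n < m]. *)
exists (a + e *+ n), (b + e *+ n); rewrite /G /= !addrK; split=> // m mn.
have bE : b = a + e by rewrite /e addrC subrK.
have [lt_mn|lt_nm|//] := ltngtP m n.
  have ge x : x + e <= x + e *+ n - e *+ m.
    rewrite -(subnKC lt_mn) mulrnDr mulrSr.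
    by have := mulrn_wge0 (n - m.+1) (ltW e0); lra.
  split=> [/Adown/(_ (ge a))|/Adown/(_ (ge b))]; first by rewrite -bE.
  by move=> Abe; case: Ab; apply: Adown Abe _; lra.
have le x : x + e *+ n - e *+ m <= x - e.
  rewrite -(subnKC lt_nm) mulrnDr mulrSr.
  by have := mulrn_wge0 (m - n.+1) (ltW e0); lra.
have Ale x : x <= b -> A (x + e *+ n - e *+ m).
  by move=> xb; apply: Adown Aa _; apply: le_trans (le x) _; rewrite /e; lra.
by split=> _; apply: Ale; lra.
Qed.

End Gaps.

(** * Lines cut at gaps *)

Section Boxes.
Variable F : rcfType.

Lemma open_box1P (a b x : 'rV[F]_1) : open_box a b x <-> a 0 0 < x 0 0 < b 0 0.
Proof. by split=> [/(_ 0)|abx i]; rewrite ?ord1. Qed.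

Lemma open_open_box1 (a b : 'rV[F]_1) : open (open_box a b).
Proof.
have -> : open_box a b = (fun x : 'rV[F]_1 => x 0 0) @^-1` [set y | a 0 0 < y < b 0 0].
  by apply/seteqP; split=> x /open_box1P.
apply: open_comp; first by move=> x _; exact: coord_continuous.
have -> : [set y | a 0 0 < y < b 0 0] = `]a 0 0, b 0 0[%classic.
  by apply/seteqP; split=> y; rewrite /= in_itv.
exact: interval_open.
Qed.

Lemma open_box1_nbhs (W : set 'rV[F]_1) (x : 'rV[F]_1) : open W -> W x ->
  exists a b, open_box a b x /\ open_box a b `<=` W.
Proof.
move=> Wo Wx; have /nbhs_ballP[e /= e0 xeW] := open_nbhs_nbhs (conj Wo Wx).
exists (const_mx (x 0 0 - e)), (const_mx (x 0 0 + e)); split.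
  by apply/open_box1P; rewrite !mxE; apply/andP; split; lra.
move=> y /open_box1P; rewrite !mxE => /andP[y1 y2]; apply: xeW; split=> // i j.
by rewrite !ord1 /ball /= /ball_ ltr_distl; apply/andP; split; lra.
Qed.

End Boxes.

(** By o-minimality, membership in a definable set is constant near the gap, whereas membership in
    this one changes there. *)
Lemma cut_not_definable (F : rcfType) (E : expansion F) (A : set F) (c d : 'rV[F]_1) :
  o_minimal E -> is_gap A -> A (c 0 0) -> ~ A (d 0 0) ->
  ~ definable E ([set x : 'rV[F]_1 | A (x 0 0)] `&` open_box c d).
Proof.
move=> Emin Agap Ac Ad /Emin[s sE].
have [u [v [Au Av uvs]]] := constant_near_gap_has s Agap.
(* The points [x] and [y] lie on the two sides of the gap, both inside the box and inside the
   neighbourhood from [u] to [v]. *)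
have [x Ax cux] : exists2 x, A x & Num.max (c 0 0) u < x.
  by apply: gap_no_max => //; case: leP.
have [y Ay ydv] : exists2 y, ~ A y & y < Num.min (d 0 0) v.
  by apply: gap_no_min => //; case: leP.
move: cux ydv; rewrite gt_max lt_min => /andP[cx ux] /andP[yd yv].
have lt_A z t := @gap_lt _ A z t Agap.
have [xd xv cy uy] : [/\ x < d 0 0, x < v, c 0 0 < y & u < y] by split; exact: lt_A.
have sP z : has (fun i => z \in i) s <->
    A z /\ c 0 0 < z < d 0 0.
  have /seteqP[s1 s2] := sE; split=> [/hasP[i si zi]|[Az zcd]].
    have [|Az /open_box1P] := s2 (const_mx z); first by exists i; rewrite ?mxE.
    by move: Az; rewrite /= !mxE.
  have [|i si] := s1 (const_mx z).
    by split; [rewrite /= mxE|apply/open_box1P; rewrite !mxE].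
  by rewrite mxE => zi; apply/hasP; exists i.
have /sP[] : has (fun i => y \in i) s.
  rewrite -(uvs x y) ?ux ?uy //.
  by apply/sP; rewrite cx xd.
by [].
Qed.

Section CutLine.
Variables (F : rcfType) (E : expansion F).
Variable G : nat -> set F.
Hypothesis Ggap : forall n, is_gap (G n).
Hypothesis Gdiscrete : forall x, exists u v, u < x < v /\
  forall n y z, u < y < v -> u < z < v -> G n y -> G n z.
Hypothesis Gsep : forall n, exists p q,
  [/\ G n p, ~ G n q & forall m, m <> n -> G m p <-> G m q].

Let L := definable_set_space E (setT : set 'rV[F]_1).

Let Lspace : is_space L.
Proof. exact: definable_set_is_space (definableT E 1). Qed.

(* The boxes that meet no gap [G n] with [n] in [S]. *)
Definition uncut_boxes (S : set nat) : set (set 'rV[F]_1) :=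
  [set B | exists c d : 'rV[F]_1,
    (forall n, S n -> G n (c 0 0) <-> G n (d 0 0)) /\ B = open_box c d].

Definition cut_line (S : set nat) : space_over F 'rV[F]_1 :=
  localization L (uncut_boxes S).

Lemma gopen_open_box (c d : 'rV[F]_1) : gopen L (open_box c d).
Proof.
split; first exact: definable_open_box.
by exists (open_box c d); [exact: open_open_box1|rewrite setTI].
Qed.

Lemma uncut_boxes_open S : uncut_boxes S `<=` gopen L.
Proof. by move=> _ [c [d [_ ->]]]; exact: gopen_open_box. Qed.

Lemma uncut_boxes_cover S (x : 'rV[F]_1) :
  exists c d, open_box c d x /\ uncut_boxes S (open_box c d).
Proof.
have [u [v [/andP[ux xv] Guv]]] := Gdiscrete (x 0 0).
(* Midpoints are taken because [Guv] compares only points strictly between [u] and [v], and the end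
   points of the box must be compared. *)
exists (const_mx ((u + x 0 0) / 2)), (const_mx ((x 0 0 + v) / 2)); split.
  by apply/open_box1P; rewrite !mxE; apply/andP; split; lra.
eexists; eexists; split; last by reflexivity.
by move=> n _; rewrite !mxE; split; apply: Guv; apply/andP; split; lra.
Qed.

Lemma cut_line_locally_definable S : locally_definable E (cut_line S).
Proof.
have Bo := @uncut_boxes_open S.
split; first exact: localization_is_space.
exists (uncut_boxes S); split.
- exact: localization_admissible.
- apply/seteqP; split=> // x _; have [c [d [xcd SB]]] := uncut_boxes_cover S x.
  by exists (open_box c d).
- move=> B SB; split.
    apply: open_subspace_is_space; first exact: localization_is_space.
    by apply: localization_open => //; exact: Bo.
  have Bdef : definable E B by case: (Bo B SB).
  exists 1%N, B; split=> //; rewrite open_subspace_localization //.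
  rewrite open_subspace_definable_set; last exact: (Bo B SB).
  by apply: space_isomorphic_refl; exact: definable_set_is_space.
Qed.

Lemma cut_line_comes_from_affine S : comes_from_affine E (cut_line S).
Proof.
have Bo := @uncut_boxes_open S.
have box_open c d : gopen (cut_line S) (open_box c d).
  by apply: localization_open => //; exact: gopen_open_box.
split=> // [W|x].
  split=> [[C Co ->]|Wo].
    apply: bigcup_open => U /Co[_ Uo].
    (* Only the traces of [U] on uncut boxes are known to be open; these boxes cover the line. *)
    have -> : U = \bigcup_(B in uncut_boxes S) (U `&` B).
      apply/seteqP; split=> [x Ux|x [B _ []] //].
      by have [c [d [xcd SB]]] := uncut_boxes_cover S x; exists (open_box c d).
    by apply: bigcup_open => B /Uo[_ [V Vo ->]]; rewrite setTI.
  exists [set B | B `<=` W /\ exists c d, B = open_box c d].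
    by move=> _ [_ [c [d ->]]].
  apply/seteqP; split=> [x Wx|x [B [BW _] /BW] //].
  have [c [d [xcd cdW]]] := open_box1_nbhs Wo Wx.
  by exists (open_box c d) => //; split=> //; exists c, d.
have [c [d [xcd SB]]] := uncut_boxes_cover S x.
by exists c, d; split=> //; exact: open_subspace_localization.
Qed.

Lemma gopen_cut_line (Emin : o_minimal E) S n :
  gopen (cut_line S) [set x | G n (x 0 0)] <-> S n.
Proof.
split=> [[_ Gopen]|Sn].
  apply: contrapT => nSn; have [p [q [Gp Gq pq]]] := Gsep n.
  (* The box from [p] to [q] crosses the [n]-th gap only, so it is uncut when [n] is not in [S]; the
     trace on it is not definable. *)
  have pqS : uncut_boxes S (open_box (const_mx p) (const_mx q)).
    exists (const_mx p), (const_mx q); split=> // m Sm; rewrite !mxE; apply: pq => mn.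
    by apply: nSn; rewrite -mn.
  have [Gdef _] := Gopen _ pqS.
  by apply: (cut_not_definable Emin (Ggap n) _ _ Gdef); rewrite mxE.
split=> // _ [c [d [cd ->]]].
(* An uncut box lies entirely on one side of the [n]-th gap, so the trace is the whole box or
   empty. *)
have [Gd|Gd] := pselect (G n (d 0 0)).
  rewrite setIidr; first exact: gopen_open_box.
  by move=> x /open_box1P/andP[_ /ltW]; exact: gap_down.
suff -> : [set x : 'rV[F]_1 | G n (x 0 0)] `&` open_box c d = set0.
  exact: (gts_A1 (space_gts Lspace)).1.
rewrite -subset0 => x [Gx /open_box1P/andP[/ltW cx _]].
by apply: Gd; rewrite -cd //; exact: (gap_down (Ggap n) Gx cx).
Qed.

End CutLine.

(** * Uncountability *)

Lemma uncountable_set_nat T (f : set nat -> T) (K : set T) :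
  injective f -> (forall S, K (f S)) -> ~ countable K.
Proof.
move=> finj fK /countable_injP[g ginj].
have h S S' : g (f S) = g (f S') -> S = S'.
  by move=> gS; apply: finj; apply: ginj => //; rewrite inE.
(* Cantor's diagonal set for the injection of sets of natural numbers into [nat]. *)
pose D := [set n | exists2 S, g (f S) = n & ~ S n].
have [DD|nDD] := pselect (D (g (f D))).
  by have [S /h -> nD] := DD; apply: nD.
by apply: (nDD); exists D.
Qed.

Theorem theorem10 (F : rcfType) (E : expansion F) (Emin : o_minimal E)
    (FnotR : ~ field_isomorphic F Rdefinitions.R) :
  ~ countable [set N : space_over F 'rV[F]_1 |
      locally_definable E N /\ comes_from_affine E N].
Proof.
have [A Agap] : exists A : set F, is_gap A.
  apply: contrapT => nogap; apply: FnotR; apply: gapless_field_isomorphic => A Agap.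
  by apply: nogap; exists A.
have [G [Ggap Gdiscrete Gsep]] := exists_gap_sequence Agap.
(* The set [S] is recovered from its line as the set of those [n] for which the lower half of the
   [n]-th gap is open. *)
apply: (@uncountable_set_nat _ (cut_line E G)) => [S S' eqN|S].
  by apply/seteqP; split=> n /(gopen_cut_line Ggap Gsep Emin);
    [rewrite eqN|rewrite -eqN] => /(gopen_cut_line Ggap Gsep Emin).
split; first exact: cut_line_locally_definable.
exact: cut_line_comes_from_affine.
Qed.
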